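(* Let $R$ be a um-ring (commutative with nonzero identity), $M$ an $R$-module, $N$ a proper submodule of $M$, and $\phi:S(M)\to S(M)\cup\{\emptyset\}$ a function. The following conditions are equivalent. (1) $N$ is a $\phi$-classical 1-absorbing prime submodule of $M$. (2) For all nonunits $a,b,c\in R$, $(N:_M abc)=(\phi(N):_M abc)$ or $(N:_M abc)=(N:_M ab)$ or $(N:_M abc)=(N:_M c)$. (3) For all nonunits $a,b,c\in R$ and every submodule $L$ of $M$, $abcL\subseteq N$ and $abcL\nsubseteq\phi(N)$ imply that $abL\subseteq N$ or $cL\subseteq N$. (4) For all nonunits $a,b\in R$ and every submodule $L$ of $M$ with $abL\nsubseteq N$, $(N:_R abL)=(\phi(N):_R abL)$ or $(N:_R abL)=(N:_R L)$. (5) For all nonunits $a,b\in R$, every ideal $J$ of $R$ and every submodule $L$ of $M$, $abJL\subseteq N$ and $abJL\nsubseteq\phi(N)$ imply that $abL\subseteq N$ or $JL\subseteq N$. (6) For every nonunit $a\in R$, all proper ideals $I,J$ of $R$ and every submodule $L$ of $M$, $aIJL\subseteq N$ and $aIJL\nsubseteq\phi(N)$ imply that $aIL\subseteq N$ or $JL\subseteq N$. (7) For all proper ideals $I,J$ of $R$ and every submodule $L$ of $M$ with $IJL\nsubseteq N$, $(N:_R IJL)=(\phi(N):_R IJL)$ or $(N:_R IJL)=(N:_R L)$. (8) For all proper ideals $I,J,K$ of $R$ and every submodule $L$ of $M$, $IJKL\subseteq N$ and $IJKL\nsubseteq\phi(N)$ imply that $IJL\subseteq N$ or $KL\subseteq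 N$.
   Context: All modules are unitary. $S(M)$ is the set of all submodules of $M$. Standing assumption: $\phi(N)\subseteq N$ for every submodule $N$. A um-ring is a ring $R$ such that every $R$-module which is equal to a finite union of submodules is equal to one of them. A proper submodule $N$ of $M$ is $\phi$-classical 1-absorbing prime if whenever $a,b,c\in R$ are nonunits and $m\in M$ with $abcm\in N\setminus\phi(N)$, then $abm\in N$ or $cm\in N$. Notation: $(A:_M a)=\{m\in M: am\in A\}$ for $a\in R$, and $(A:_R X)=\{r\in R: rX\subseteq A\}$ for $X\subseteq M$; when $A=\emptyset$ these sets are empty (for nonempty $X$). *)

(* Defs.v *)
From HB Require Import structures.
From mathcomp Require Import all_boot all_order all_algebra.
From mathcomp Require Import boolp classical_sets.

Set Implicit Arguments.
Unset Strict Implicit.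
Unset Printing Implicit Defensive.

Import GRing.Theory.
Local Open Scope classical_set_scope.
Local Open Scope ring_scope.

(* A submodule of [M] is a [submodClosed M], with underlying set [[set` N]];  *)
(* it is a boolean predicate, which is no restriction in classical logic.     *)
(* An ideal of [R] is a submodule of the regular module [R^o]; it may be the  *)
(* whole ring.                                                                *)
Definition ideal (R : comUnitRingType) : Type :=
  GRing.SubmodClosed.type (R^o : lmodType R).

Definition ideal_set (R : comUnitRingType) (I : ideal R) : set R :=
  [set r : R | (r : R^o) \in I].

Definition ideal_proper (R : comUnitRingType) (I : ideal R) : Prop :=
  ideal_set I <> setT.

Definition submod_proper (R : comUnitRingType) (M : lmodType R)
  (N : submodClosed M) : Prop := [set` N] <> setT.

(* The case n = 0 is harmless: an empty union is never a whole module.        *)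
Definition um_ring (R : comUnitRingType) : Prop :=
  forall (M : lmodType R) (n : nat) (N : 'I_n -> submodClosed M),
    \bigcup_i [set` N i] = setT -> exists i, [set` N i] = setT.

(* A function from S(M) to S(M) + {emptyset} has codomain                     *)
(* [option (submodClosed M)], where [None] stands for the empty set.          *)
Definition option_set (R : comUnitRingType) (M : lmodType R)
  (K : option (submodClosed M)) : set M :=
  if K is Some K' then [set` K'] else set0.

Definition scale_set (R : comUnitRingType) (M : lmodType R)
  (a : R) (X : set M) : set M := [set a *: x | x in X].

(* The submodule generated by the products r x, not just the set of these     *)
(* products.                                                                  *)
Definition mul_set (R : comUnitRingType) (M : lmodType R)
  (I : ideal R) (X : set M) : set M :=
  smallest (fun A : set M => submod_closed [in A])
    [set r *: x | r in ideal_set I & x in X].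

Definition colonM (R : comUnitRingType) (M : lmodType R)
  (A : set M) (a : R) : set M := [set m | A (a *: m)].

Definition colonR (R : comUnitRingType) (M : lmodType R)
  (A X : set M) : set R := [set r | scale_set r X `<=` A].

Definition classical_1abs_prime (R : comUnitRingType) (M : lmodType R)
  (phi : submodClosed M -> option (submodClosed M)) (N : submodClosed M)
  : Prop :=
  submod_proper N /\
  forall (a b c : R) (m : M),
    a \isn't a GRing.unit -> b \isn't a GRing.unit -> c \isn't a GRing.unit ->
    ([set` N] `\` option_set (phi N)) ((a * b * c) *: m) ->
    (a * b) *: m \in N \/ c *: m \in N.

(* Main.v *)
Require Import Defs.
From HB Require Import structures.
From mathcomp Require Import all_boot all_order all_algebra.
From mathcomp Require Import boolp classical_sets.
From mathcomp Require Import ring.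

Set Implicit Arguments.
Unset Strict Implicit.
Unset Printing Implicit Defensive.

Import GRing.Theory.
Local Open Scope classical_set_scope.
Local Open Scope ring_scope.

(* A submodule covered by three submodules lies in one of them, because R is  *)
(* a um-ring; applied to (N : abc), this turns the pointwise condition (1)    *)
(* into (2). In (3) => (4), (5) => (6) and (6) => (7) one fixes all factors   *)
(* but one: the admissible values of the remaining factor form an ideal of R  *)
(* covered by two others, one where the product falls into phi(N) and one     *)
(* where the conclusion holds; no additive group is the union of two proper   *)
(* subgroups, whatever the ring. For (6) => (7), given c with cIJL in N,      *)
(* condition (6) is applied to r in I and to the ideals J and Rc. Finally (8) *)
(* => (1) is the case of principal ideals and a cyclic submodule.             *)

(** The implications run in one cycle. Where two or three sets compete, the set at hand is shown to
    be covered by them, and a covering lemma singles one out: [sub_union3], resting on the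
    um-hypothesis, for (1) => (2), and [sub_union2] for (3) => (4), (5) => (6) and (6) => (7). The
    steps (4) => (5) and (7) => (8) are residuation: abJL lies in A exactly when J lies in (A :
    abL), and IJKL lies in A exactly when K lies in (A : IJL).

    Units cause no trouble: a unit that carries abL or IJL into N shows that this submodule is
    already inside N, and a proper ideal contains only nonunits ([ideal_proper_nonunit]).

    Inclusions of products are tested on elements by [mul_set_subP] and its iterates. As phi(N) may
    be empty, these lemmas and the covering lemmas are stated for [lin_stable] sets, which are the
    submodules together with the empty set. *)

Lemma scaler_swap (R : comUnitRingType) (V : lmodType R) (a b : R) (x : V) :
  a *: (b *: x) = b *: (a *: x).
Proof. by rewrite !scalerA mulrC. Qed.

(** * Submodules as modules, and linearly stable sets *)

(** The um-hypothesis speaks of coverings of a whole module; to apply it to a submodule, the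
    submodule has to become an [lmodType] of its own. *)
Definition submod_carrier (R : comUnitRingType) (M : lmodType R)
  (C : submodClosed M) : Type := {x : M | x \in C}.

HB.instance Definition _ (R : comUnitRingType) (M : lmodType R)
  (C : submodClosed M) := SubType.on (submod_carrier C).
HB.instance Definition _ (R : comUnitRingType) (M : lmodType R)
  (C : submodClosed M) := [Choice of submod_carrier C by <:].
HB.instance Definition _ (R : comUnitRingType) (M : lmodType R)
  (C : submodClosed M) := [SubChoice_isSubLmodule of submod_carrier C by <:].

(* Unlike [submod_closed], this admits the empty set, so that it holds of     *)
(* [option_set (phi N)] in all cases.                                         *)
Definition lin_stable (R : comUnitRingType) (V : lmodType R) (A : set V)
  : Prop :=
  forall (a : R) (x y : V), A x -> A y -> A (a *: x + y).

Lemma lin_stable0 (R : comUnitRingType) (V : lmodType R) (A : set V) (x : V) :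
  lin_stable A -> A x -> A 0.
Proof. by move=> sA Ax; have := sA (-1) x x Ax Ax; rewrite scaleN1r addNr. Qed.

Lemma lin_stableZ (R : comUnitRingType) (V : lmodType R) (A : set V)
  (a : R) (x : V) : lin_stable A -> A x -> A (a *: x).
Proof.
by move=> sA Ax; rewrite -[a *: x]addr0; apply: sA (lin_stable0 sA Ax).
Qed.

Lemma lin_stable_option_set (R : comUnitRingType) (M : lmodType R)
  (K : option (submodClosed M)) : lin_stable (option_set K).
Proof.
by case: K => [K|] a x y //= Kx Ky; apply: rpredD => //; apply: rpredZ.
Qed.

Lemma lin_stable_preimage (R : comUnitRingType) (U V : lmodType R)
  (f : {linear U -> V}) (A : set V) : lin_stable A -> lin_stable (f @^-1` A).
Proof. by move=> sA a x y /= Ax Ay; rewrite linearP; apply: sA. Qed.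

Lemma lin_stable_colonM (R : comUnitRingType) (M : lmodType R) (A : set M)
  (a : R) : lin_stable A -> lin_stable (colonM A a).
Proof.
move=> sA b x y; rewrite /colonM /= => Ax Ay.
by rewrite scalerDr scalerA mulrC -scalerA; apply: sA.
Qed.

(** * Residuals and products of ideals, tested on elements *)

Lemma colonRP (R : comUnitRingType) (M : lmodType R) (A X : set M) (r : R) :
  colonR A X r <-> forall x, X x -> A (r *: x).
Proof. by split=> [rX x Xx|rX _ [x Xx <-]]; apply: rX => //; exists x. Qed.

Lemma scale_subP (R : comUnitRingType) (M : lmodType R) (A X : set M) (a : R) :
  scale_set a X `<=` A <-> forall x, X x -> A (a *: x).
Proof. exact: colonRP. Qed.

Lemma lin_stable_colonR (R : comUnitRingType) (M : lmodType R) (A X : set M) :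
  lin_stable A -> lin_stable (colonR A X : set R^o).
Proof.
move=> sA a r s /colonRP rX /colonRP sX; apply/colonRP => x Xx.
by rewrite scalerDl -scalerA; apply: sA; [apply: rX|apply: sX].
Qed.

Lemma submod_of_lin_stable (R : comUnitRingType) (V : lmodType R) (A : set V)
  (x : V) : lin_stable A -> A x -> exists S : submodClosed V, [set` S] = A.
Proof.
move=> sA Ax.
have cA : submod_closed [in A].
  split=> [|a y z]; rewrite !inE; first exact: lin_stable0 sA Ax.
  exact: sA.
pose S : submodClosed V :=
  HB.pack_for (submodClosed V) ([in A] : {pred V})
    (GRing.isSubmodClosed.Build R V [in A] cA).
by exists S; apply/seteqP; split=> y /=; rewrite inE.
Qed.

(** The element [x0] settles the case of empty [A]: either side puts 0 in [A], so both fail.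
    Otherwise [A] is a submodule and it suffices to test generators. *)
Lemma mul_set_subP (R : comUnitRingType) (M : lmodType R) (I : ideal R)
  (A X : set M) (x0 : M) : lin_stable A -> X x0 ->
  mul_set I X `<=` A <-> forall r x, ideal_set I r -> X x -> A (r *: x).
Proof.
move=> sA Xx0; split=> [sub r x Ir Xx|AIX].
  by apply: sub; apply: sub_gen_smallest; exists r => //; exists x.
apply: smallest_sub => [|_ [r Ir [x Xx <-]]]; last exact: AIX.
split=> [|a y z]; rewrite !inE; last exact: sA.
by rewrite -(scale0r x0); apply: AIX => //; apply: rpred0.
Qed.

Lemma mul_set0 (R : comUnitRingType) (M : lmodType R) (I : ideal R)
  (X : set M) : mul_set I X 0.
Proof. by move=> A /= -[[+ _] _]; rewrite inE. Qed.

(** The scalar is absorbed into the target: this is an inclusion in [colonM A a], which is again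
    linearly stable. *)
Lemma scale_mul_subP (R : comUnitRingType) (M : lmodType R) (I : ideal R)
  (A X : set M) (x0 : M) (a : R) : lin_stable A -> X x0 ->
  (forall y, mul_set I X y -> A (a *: y)) <->
  forall r x, ideal_set I r -> X x -> A (a *: (r *: x)).
Proof. by move=> sA; apply: mul_set_subP; apply: lin_stable_colonM. Qed.

Lemma scale_mul2_subP (R : comUnitRingType) (M : lmodType R) (I J : ideal R)
  (A X : set M) (x0 : M) (a : R) : lin_stable A -> X x0 ->
  (forall y, mul_set I (mul_set J X) y -> A (a *: y)) <->
  forall r s x, ideal_set I r -> ideal_set J s -> X x ->
    A (a *: (r *: (s *: x))).
Proof.
move=> sA Xx0; rewrite (scale_mul_subP _ _ sA (@mul_set0 _ _ J X)); split.
  move=> h r s x Ir Js Xx; apply: (h r) => //.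
  by apply: sub_gen_smallest; exists s => //; exists x.
move=> h r x Ir; move: x.
have sAr := @lin_stable_colonM _ _ _ r (@lin_stable_colonM _ _ _ a sA).
by apply/(mul_set_subP _ sAr Xx0) => s x Js Xx; apply: h.
Qed.

Lemma mul_set2_subP (R : comUnitRingType) (M : lmodType R) (I J : ideal R)
  (A X : set M) (x0 : M) : lin_stable A -> X x0 ->
  mul_set I (mul_set J X) `<=` A <->
  forall r s x, ideal_set I r -> ideal_set J s -> X x -> A (r *: (s *: x)).
Proof.
move=> sA Xx0; have := scale_mul2_subP I J 1 sA Xx0.
move=> [h1 h2]; split=> [sub r s x Ir Js Xx|h y].
  by rewrite -[_ *: _]scale1r; apply: h1 => // y ?; rewrite scale1r; apply: sub.
by rewrite -{2}[y]scale1r; apply: h2 => *; rewrite scale1r; apply: h.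
Qed.

Lemma mul_set3_subP (R : comUnitRingType) (M : lmodType R) (I J K : ideal R)
  (A X : set M) (x0 : M) : lin_stable A -> X x0 ->
  mul_set I (mul_set J (mul_set K X)) `<=` A <->
  forall r s t x, ideal_set I r -> ideal_set J s -> ideal_set K t -> X x ->
    A (r *: (s *: (t *: x))).
Proof.
move=> sA Xx0; rewrite (mul_set_subP _ sA (@mul_set0 _ _ J _)); split=> h r.
  move=> s t x Ir; move: s t x; apply/(scale_mul2_subP _ _ _ sA Xx0).
  by move=> y; apply: h.
by move=> x Ir; move: x; apply/(scale_mul2_subP _ _ _ sA Xx0) => *; apply: h.
Qed.

(** * Coverings by two or three sets *)

(** If x in C avoids A and y in C avoids B, then x is in B and y in A, so x + y can be in
    neither. *)
Lemma sub_union2 (R : comUnitRingType) (V : lmodType R) (C A B : set V) :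
  lin_stable C -> lin_stable A -> lin_stable B ->
  C `<=` A `|` B -> C `<=` A \/ C `<=` B.
Proof.
move=> sC sA sB CAB; apply: contrapT => /not_orP[].
move=> /existsNP[x /not_implyP[Cx nAx]] /existsNP[y /not_implyP[Cy nBy]].
have Bx : B x by case: (CAB x Cx).
have Ay : A y by case: (CAB y Cy).
have [Axy|Bxy] := CAB _ (sC 1 x y Cx Cy).
  apply: nAx; have := sA (-1) _ _ Ay Axy.
  by rewrite scale1r scaleN1r addrC addrK.
by apply: nBy; have := sB (-1) _ _ Bx Bxy; rewrite scale1r scaleN1r addKr.
Qed.

Lemma sub_union2_ring (R : comUnitRingType) (C A B : set R) :
  lin_stable (C : set R^o) -> lin_stable (A : set R^o) ->
  lin_stable (B : set R^o) -> C `<=` A `|` B -> C `<=` A \/ C `<=` B.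
Proof. exact: (@sub_union2 _ R^o). Qed.

(** The um-hypothesis is applied to C as a module, covered by the traces of the three sets. [A1] is
    meant for the residual of phi(N) and may be empty. *)
Lemma sub_union3 (R : comUnitRingType) (hR : um_ring R) (M : lmodType R)
  (C : submodClosed M) (A1 A2 A3 : set M) :
  lin_stable A1 -> lin_stable A2 -> lin_stable A3 -> A2 0 -> A3 0 ->
  [set` C] `<=` A1 `|` A2 `|` A3 ->
  [\/ [set` C] `<=` A1, [set` C] `<=` A2 | [set` C] `<=` A3].
Proof.
move=> s1 s2 s3 A20 A30 CA.
(* An empty [A1] is not a submodule, but then the other two sets already cover C. *)
have [[x A1x]|A1_empty] := pselect (exists x, A1 x); last first.
  have CA23 : [set` C] `<=` A2 `|` A3.
    by move=> x /CA [[A1x|]|]; [case: A1_empty; exists x|left|right].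
  have sC : lin_stable [set` C] := @lin_stable_option_set _ _ (Some C).
  by have [] := sub_union2 sC s2 s3 CA23; [constructor 2|constructor 3].
have A10 := lin_stable0 s1 A1x.
(* The trace of A on C is the preimage of A under the inclusion of C in M, which is linear. *)
have restr (A : set M) : lin_stable A -> A 0 ->
    exists S : submodClosed (submod_carrier C), [set` S] = val @^-1` A.
  pose f : {linear submod_carrier C -> M} := val.
  move=> sA A0; apply: (@submod_of_lin_stable _ _ (f @^-1` A) 0).
    exact: lin_stable_preimage.
  by rewrite /preimage /mkset linear0.
have [S1 ES1] := restr _ s1 A10; have [S2 ES2] := restr _ s2 A20.
have [S3 ES3] := restr _ s3 A30.
have sub (S : submodClosed (submod_carrier C)) A :
    [set` S] = val @^-1` A -> [set` S] = setT -> [set` C] `<=` A.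
  move=> -> ST y Cy.
  by suff : (val @^-1` A) (Sub y Cy : submod_carrier C) by []; rewrite ST.
have [|i Si] := hR (submod_carrier C) 3
      (fun i => match val i with 0 => S1 | 1 => S2 | _ => S3 end).
  apply/seteqP; split=> // y _.
  have [[A1y|A2y]|A3y] := CA _ (valP y).
  - exists (inord 0) => //; rewrite /= inordK //.
    by change ([set` S1] y); rewrite ES1.
  - exists (inord 1) => //; rewrite /= inordK //.
    by change ([set` S2] y); rewrite ES2.
  - exists (inord 2) => //; rewrite /= inordK //.
    by change ([set` S3] y); rewrite ES3.
move: Si; case: i => -[|[|[|//]]] /= _ ST.
- by constructor 1; apply: sub ES1 ST.
- by constructor 2; apply: sub ES2 ST.
- by constructor 3; apply: sub ES3 ST.
Qed.

(** * From elements to ideals and submodules, and back *)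

(** A unit r in I would put every s = (s / r) r in I. *)
Lemma ideal_proper_nonunit (R : comUnitRingType) (I : ideal R) (r : R) :
  ideal_proper I -> ideal_set I r -> r \isn't a GRing.unit.
Proof.
move=> pI Ir; apply/negP => ur; apply: pI; apply/seteqP; split=> // s _.
have := @rpredZ _ _ I (s / r) (r : R^o) Ir.
by rewrite /ideal_set /= [_ *: _]divrK.
Qed.

Lemma cyclic_submod (R : comUnitRingType) (V : lmodType R) (x : V) :
  exists S : submodClosed V, [set` S] = [set r *: x | r in setT].
Proof.
apply: (@submod_of_lin_stable _ _ _ x); last by exists 1 => //; rewrite scale1r.
move=> a _ _ [r _ <-] [s _ <-]; exists (a * r + s) => //.
by rewrite scalerDl scalerA.
Qed.

Lemma principal_ideal (R : comUnitRingType) (a : R) :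
  exists I : ideal R, ideal_set I = [set r * a | r in setT] /\
    (a \isn't a GRing.unit -> ideal_proper I).
Proof.
have [I EI] := @cyclic_submod R R^o a; exists I.
have {}EI : ideal_set I = [set r * a | r in setT] by [].
split=> // nua IT; have : ideal_set I 1 by rewrite IT.
rewrite EI => -[r _ ra]; move/negP: nua; apply.
by apply/unitrPr; exists r; rewrite mulrC.
Qed.

(** * The cycle of implications *)

Theorem theorem6 (R : comUnitRingType) (hR : um_ring R) (M : lmodType R)
  (phi : submodClosed M -> option (submodClosed M))
  (hphi : forall K : submodClosed M, option_set (phi K) `<=` [set` K])
  (N : submodClosed M) (hN : submod_proper N) :
  let n := [set` N] in
  let p := option_set (phi N) in
  [<->
   (* (1) *)
   classical_1abs_prime phi N;
   (* (2) *)
   forall a b c : R,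
     a \isn't a GRing.unit -> b \isn't a GRing.unit ->
     c \isn't a GRing.unit ->
     [\/ colonM n (a * b * c) = colonM p (a * b * c),
         colonM n (a * b * c) = colonM n (a * b) |
         colonM n (a * b * c) = colonM n c];
   (* (3) *)
   forall (a b c : R) (L : submodClosed M),
     a \isn't a GRing.unit -> b \isn't a GRing.unit ->
     c \isn't a GRing.unit ->
     scale_set (a * b * c) [set` L] `<=` n ->
     ~ (scale_set (a * b * c) [set` L] `<=` p) ->
     scale_set (a * b) [set` L] `<=` n \/ scale_set c [set` L] `<=` n;
   (* (4) *)
   forall (a b : R) (L : submodClosed M),
     a \isn't a GRing.unit -> b \isn't a GRing.unit ->
     ~ (scale_set (a * b) [set` L] `<=` n) ->
     colonR n (scale_set (a * b) [set` L]) =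
       colonR p (scale_set (a * b) [set` L]) \/
     colonR n (scale_set (a * b) [set` L]) = colonR n [set` L];
   (* (5) *)
   forall (a b : R) (J : ideal R) (L : submodClosed M),
     a \isn't a GRing.unit -> b \isn't a GRing.unit ->
     scale_set (a * b) (mul_set J [set` L]) `<=` n ->
     ~ (scale_set (a * b) (mul_set J [set` L]) `<=` p) ->
     scale_set (a * b) [set` L] `<=` n \/ mul_set J [set` L] `<=` n;
   (* (6) *)
   forall (a : R) (I J : ideal R) (L : submodClosed M),
     a \isn't a GRing.unit -> ideal_proper I -> ideal_proper J ->
     scale_set a (mul_set I (mul_set J [set` L])) `<=` n ->
     ~ (scale_set a (mul_set I (mul_set J [set` L])) `<=` p) ->
     scale_set a (mul_set I [set` L]) `<=` n \/
     mul_set J [set` L] `<=` n;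
   (* (7) *)
   forall (I J : ideal R) (L : submodClosed M),
     ideal_proper I -> ideal_proper J ->
     ~ (mul_set I (mul_set J [set` L]) `<=` n) ->
     colonR n (mul_set I (mul_set J [set` L])) =
       colonR p (mul_set I (mul_set J [set` L])) \/
     colonR n (mul_set I (mul_set J [set` L])) = colonR n [set` L];
   (* (8) *)
   forall (I J K : ideal R) (L : submodClosed M),
     ideal_proper I -> ideal_proper J -> ideal_proper K ->
     mul_set I (mul_set J (mul_set K [set` L])) `<=` n ->
     ~ (mul_set I (mul_set J (mul_set K [set` L])) `<=` p) ->
     mul_set I (mul_set J [set` L]) `<=` n \/
     mul_set K [set` L] `<=` n
  ].
Proof.
move=> n p.
have sn : lin_stable n := @lin_stable_option_set _ _ (Some N).
have sp : lin_stable p := @lin_stable_option_set _ _ (phi N).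
have pn : p `<=` n := hphi N.
have n0 : n 0 by apply: rpred0.
have nZ r x : n x -> n (r *: x) by apply: lin_stableZ.
have submod0 (L : submodClosed M) : [set` L] 0 by apply: rpred0.
tfae.
(* (1) => (2): by (1), the three residuals on the right cover (N : abc); each lies in it, so the one
   that contains it equals it. *)
- move=> [_ prN] a b c ua ub uc.
  have [|C EC] := @submod_of_lin_stable _ _ (colonM n (a * b * c)) 0
      (@lin_stable_colonM _ _ _ _ sn); first by rewrite /colonM /= scaler0.
  have sub1 : colonM p (a * b * c) `<=` colonM n (a * b * c).
    by move=> m; apply: pn.
  have sub2 : colonM n (a * b) `<=` colonM n (a * b * c).
    by move=> m /(nZ c); rewrite scalerA mulrC.
  have sub3 : colonM n c `<=` colonM n (a * b * c).
    by move=> m /(nZ (a * b)); rewrite scalerA.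
  have [||||||CA|CA|CA] := @sub_union3 _ hR _ C (colonM p (a * b * c))
      (colonM n (a * b)) (colonM n c).
  + exact: lin_stable_colonM.
  + exact: lin_stable_colonM.
  + exact: lin_stable_colonM.
  + by rewrite /colonM /= scaler0.
  + by rewrite /colonM /= scaler0.
  + rewrite EC => m nm; have [pm|npm] := pselect (p ((a * b * c) *: m)).
      by left; left.
    by have [] := prN a b c m ua ub uc (conj nm npm); [left; right|right].
  + by constructor 1; apply/seteqP; split; rewrite // -EC.
  + by constructor 2; apply/seteqP; split; rewrite // -EC.
  + by constructor 3; apply/seteqP; split; rewrite // -EC.
- move=> h2 a b c L ua ub uc /scale_subP Ln /scale_subP nLp.
  have [E|E|E] := h2 a b c ua ub uc.
  + case: nLp => x Lx.
    by have : colonM n (a * b * c) x := Ln x Lx; rewrite E.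
  + left; apply/scale_subP => x Lx.
    by have : colonM n (a * b * c) x := Ln x Lx; rewrite E.
  + right; apply/scale_subP => x Lx.
    by have : colonM n (a * b * c) x := Ln x Lx; rewrite E.
- move=> h3 a b L ua ub nabL.
  set X := scale_set (a * b) [set` L].
  have colonX A c : colonR A X c <-> scale_set (a * b * c) [set` L] `<=` A.
    rewrite colonRP scale_subP; split=> h x Lx.
      by rewrite mulrC -scalerA; apply: h; exists x.
    by case: Lx => y Ly <-; rewrite scalerA mulrC; apply: h.
  have sub1 : colonR p X `<=` colonR n X by move=> c cp x /cp/pn.
  have sub2 : colonR n [set` L] `<=` colonR n X.
    move=> c /colonRP cn; apply/colonX/scale_subP => x Lx.
    by rewrite -scalerA; apply/nZ/cn.
  have [|CA|CA] := @sub_union2_ring _ (colonR n X) (colonR p X)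
      (colonR n [set` L])
      (@lin_stable_colonR _ _ _ _ sn) (@lin_stable_colonR _ _ _ _ sp)
      (@lin_stable_colonR _ _ _ _ sn).
  + move=> c /colonX cn; have [|ncp] := pselect (colonR p X c); first by left.
    (* Condition (3) only accepts nonunits; were c a unit, multiplying by its inverse would give abL
       in N. *)
    right; have uc : c \isn't a GRing.unit.
      apply/negP => uc; apply: nabL; apply/scale_subP => x Lx.
      move/scale_subP: cn => /(_ x Lx) /(nZ c^-1).
      by rewrite scalerA mulrC mulrK.
    have [|//|cL] := h3 a b c L ua ub uc cn; last exact: cL.
    by move=> /colonX.
  + by left; apply/seteqP.
  + by right; apply/seteqP.
- move=> h4 a b J L ua ub.
  have abJL A : lin_stable A ->
      scale_set (a * b) (mul_set J [set` L]) `<=` A <->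
      ideal_set J `<=` colonR A (scale_set (a * b) [set` L]).
    move=> sA; rewrite scale_subP (scale_mul_subP _ _ sA (submod0 L)); split.
      move=> h r Jr; apply/colonRP => _ [x Lx <-].
      by rewrite scalerA mulrC -scalerA; apply: h.
    move=> h r x Jr Lx; move/colonRP: (h r Jr) => /(_ ((a * b) *: x)).
    by rewrite !scalerA [r * _]mulrC; apply; exists x.
  move=> /(abJL _ sn) Jn nJp.
  have [|nabL] := pselect (scale_set (a * b) [set` L] `<=` n); first by left.
  have [E|E] := h4 a b L ua ub nabL.
    by case: nJp; apply/(abJL _ sp); rewrite -E.
  right; apply/(mul_set_subP _ sn (submod0 L)) => r x Jr Lx.
  by move: (Jn r Jr); rewrite E => /colonRP; apply.
- move=> h5 a I J L ua pI pJ.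
  move=> /scale_subP/(scale_mul2_subP _ _ _ sn (submod0 L)) IJn.
  move=> /scale_subP nIJp.
  have [|nJL] := pselect (mul_set J [set` L] `<=` n); first by right.
  have aiJL A i : lin_stable A ->
      scale_set (a * i) (mul_set J [set` L]) `<=` A <->
      colonR A [set a *: (s *: x) | s in ideal_set J & x in [set` L]] i.
    move=> sA; rewrite scale_subP (scale_mul_subP _ _ sA (submod0 L)) colonRP.
    split=> [h _ [s Js [x Lx <-]]|h s x Js Lx].
      by rewrite scalerA [i * a]mulrC; apply: h.
    by rewrite mulrC -scalerA; apply: h; exists s => //; exists x.
  (* As JL is not in N, (5) applied to each i in I puts aiJL in phi(N) or aiL in N. If the first
     holds for all of I, then aIJL lies in phi(N), which is excluded; if the second does, then aIL
     lies in N. *)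
  have [| IA|IA] := @sub_union2_ring _ (ideal_set I)
      (colonR p [set a *: (s *: x) | s in ideal_set J & x in [set` L]])
      (colonR n (scale_set a [set` L]))
      (@lin_stable_option_set _ R^o (Some I)) (@lin_stable_colonR _ _ _ _ sp)
      (@lin_stable_colonR _ _ _ _ sn).
  + move=> i Ii.
    have [|nip] := pselect (scale_set (a * i) (mul_set J [set` L]) `<=` p).
      by move/(aiJL _ _ sp); left.
    right; have [|aiL|//] := h5 a i J L ua (ideal_proper_nonunit pI Ii) _ nip.
      apply/(aiJL _ _ sn)/colonRP => _ [s Js [x Lx <-]].
      by rewrite scalerA mulrC -scalerA; apply: IJn.
    apply/colonRP => _ [x Lx <-]; rewrite scalerA mulrC.
    by move/scale_subP: aiL; apply.
  + case: nIJp; apply/(scale_mul2_subP _ _ _ sp (submod0 L)) => r s x Ir Js Lx.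
    move/colonRP: (IA r Ir) => /(_ (a *: (s *: x))).
    by rewrite (scaler_swap r); apply; exists s => //; exists x.
  + left; apply/scale_subP/(scale_mul_subP _ _ sn (submod0 L)) => r x Ir Lx.
    move/colonRP: (IA r Ir) => /(_ (a *: x)).
    by rewrite (scaler_swap r); apply; exists x.
- move=> h6 I J L pI pJ nIJL.
  set X := mul_set I (mul_set J [set` L]).
  have colonX A c : lin_stable A -> colonR A X c <->
      forall r s x, ideal_set I r -> ideal_set J s -> [set` L] x ->
        A (c *: (r *: (s *: x))).
    by move=> sA; rewrite colonRP; apply: (scale_mul2_subP _ _ _ sA (submod0 L)).
  have sub1 : colonR p X `<=` colonR n X by move=> c cp x /cp/pn.
  have sub2 : colonR n [set` L] `<=` colonR n X.
    move=> c /colonRP cn; apply/(colonX _ _ sn) => r s x Ir Js Lx.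
    by rewrite scaler_swap (scaler_swap c); apply/nZ/nZ/cn.
  have [|CA|CA] := @sub_union2_ring _ (colonR n X) (colonR p X)
      (colonR n [set` L])
      (@lin_stable_colonR _ _ _ _ sn) (@lin_stable_colonR _ _ _ _ sp)
      (@lin_stable_colonR _ _ _ _ sn).
  + move=> c /(colonX _ _ sn) cn.
    have [|ncp] := pselect (colonR p X c); [by left|right].
    have uc : c \isn't a GRing.unit.
      apply/negP => uc; apply/nIJL/(mul_set2_subP _ _ sn (submod0 L)).
      move=> r s x Ir Js Lx; move: (nZ c^-1 _ (cn r s x Ir Js Lx)).
      by rewrite [c^-1 *: _]scalerA mulVr ?scale1r.
    have [Kc [EKc /(_ uc) pKc]] := principal_ideal c.
    have Kcc : ideal_set Kc c by rewrite EKc; exists 1; rewrite ?mul1r.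
    (* Suppose cL is not in N. For r in I, condition (6) for r, J and Rc puts rcJL in phi(N) or rJL
       in N. By a second covering argument, on I, one alternative holds throughout: cIJL in phi(N)
       or IJL in N, both excluded. *)
    apply: contrapT => ncL.
    have [|IA|IA] := @sub_union2_ring _ (ideal_set I)
        (colonR p [set c *: (s *: x) | s in ideal_set J & x in [set` L]])
        (colonR n [set s *: x | s in ideal_set J & x in [set` L]])
        (@lin_stable_option_set _ R^o (Some I)) (@lin_stable_colonR _ _ _ _ sp)
        (@lin_stable_colonR _ _ _ _ sn).
    * move=> r Ir; apply: contrapT => /not_orP[nrp nrn].
      have [|rp|rn|Kn] := h6 r J Kc L (ideal_proper_nonunit pI Ir) pJ pKc.
      - apply/scale_subP/(scale_mul2_subP _ _ _ sn (submod0 L)) => s t x Js.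
        rewrite EKc => -[u _ <-] Lx.
        rewrite !scalerA (_ : r * s * (u * c) = u * (c * r * s)); last by ring.
        by rewrite -!scalerA; apply/nZ/cn.
      - apply: nrp; apply/colonRP => _ [s Js [x Lx <-]].
        move/scale_subP/(scale_mul2_subP _ _ _ sp (submod0 L)): rp.
        move=> /(_ s c x Js Kcc Lx).
        by rewrite (scaler_swap s).
      - apply: nrn; apply/colonRP => _ [s Js [x Lx <-]].
        by move/scale_subP/(scale_mul_subP _ _ sn (submod0 L)): rn; apply.
      - apply: ncL; apply/colonRP => x Lx.
        by move/(mul_set_subP _ sn (submod0 L)): Kn; apply.
    * apply: ncp; apply/(colonX _ _ sp) => r s x Ir Js Lx.
      move/colonRP: (IA r Ir) => /(_ (c *: (s *: x))).
      by rewrite (scaler_swap r); apply; exists s => //; exists x.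
    * apply: nIJL; apply/(mul_set2_subP _ _ sn (submod0 L)) => r s x Ir Js Lx.
      by move/colonRP: (IA r Ir); apply; exists s => //; exists x.
  + by left; apply/seteqP.
  + by right; apply/seteqP.
- move=> h7 I J K L pI pJ pK.
  have IJKL A : lin_stable A ->
      mul_set I (mul_set J (mul_set K [set` L])) `<=` A <->
      ideal_set K `<=` colonR A (mul_set I (mul_set J [set` L])).
    move=> sA; rewrite (mul_set3_subP _ _ _ sA (submod0 L)); split.
      move=> h t Kt; apply/colonRP/(scale_mul2_subP _ _ _ sA (submod0 L)).
      by move=> r s x Ir Js Lx; rewrite scaler_swap (scaler_swap t); apply: h.
    move=> h r s t x Ir Js Kt Lx; rewrite (scaler_swap s) scaler_swap.
    by move/colonRP/(scale_mul2_subP _ _ _ sA (submod0 L)): (h t Kt); apply.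
  move=> /(IJKL _ sn) Kn nKp.
  have [|nIJL] := pselect (mul_set I (mul_set J [set` L]) `<=` n); first by left.
  have [E|E] := h7 I J L pI pJ nIJL.
    by case: nKp; apply/(IJKL _ sp); rewrite -E.
  right; apply/(mul_set_subP _ sn (submod0 L)) => t x Kt Lx.
  by move: (Kn t Kt); rewrite E => /colonRP; apply.
- move=> h8; split=> // a b c m ua ub uc [nm npm].
  have [I [EI /(_ ua) pI]] := principal_ideal a.
  have [J [EJ /(_ ub) pJ]] := principal_ideal b.
  have [K [EK /(_ uc) pK]] := principal_ideal c.
  have [L EL] := cyclic_submod m.
  have Ia : ideal_set I a by rewrite EI; exists 1; rewrite ?mul1r.
  have Jb : ideal_set J b by rewrite EJ; exists 1; rewrite ?mul1r.
  have Kc : ideal_set K c by rewrite EK; exists 1; rewrite ?mul1r.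
  have Lm : [set` L] m by rewrite EL; exists 1; rewrite ?scale1r.
  have [|IJKp|IJn|Kn] := h8 I J K L pI pJ pK.
  (* Every generator of the product of Ra, Rb, Rc and Rm is a multiple of abcm, hence in N. *)
  + apply/(mul_set3_subP _ _ _ sn (submod0 L)) => r s t x.
    rewrite EI EJ EK EL => -[r' _ <-] [s' _ <-] [t' _ <-] [u _ <-].
    rewrite !scalerA.
    rewrite (_ : _ * u = r' * s' * t' * u * (a * b * c)); last by ring.
    by rewrite -scalerA; apply: nZ.
  (* The element abcm itself belongs to the product, so the product cannot lie in phi(N). *)
  + case: npm; rewrite -!scalerA.
    by move/(mul_set3_subP _ _ _ sp (submod0 L)): IJKp; apply.
  + left; rewrite -scalerA.
    by move/(mul_set2_subP _ _ sn (submod0 L)): IJn; apply.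
  + by right; move/(mul_set_subP _ sn (submod0 L)): Kn; apply.
Qed.
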